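(* The category $\mathbf{L_a}$ of bounded lattices with admissible homomorphisms is dually equivalent to the category $\mathbf{tTSCP}$ of tight totally separated compact polarities.
   Context: All lattices are bounded; lattice homomorphisms preserve $0$ and $1$. The category $\mathbf{L_a}$: A finite subset $M$ of a lattice $L$ is join-admissible if $a \wedge \bigvee M = \bigvee_{m\in M}(a\wedge m)$ for all $a \in L$, and meet-admissible if $a \vee \bigwedge M = \bigwedge_{m \in M}(a \vee m)$ for all $a \in L$. An admissible homomorphism is a lattice homomorphism sending join-admissible subsets to join-admissible subsets and meet-admissible subsets to meet-admissible subsets. $\mathbf{L_a}$ has bounded lattices as objects and admissible homomorphisms as morphisms. Polarities: For sets $X,Y$ and $R \subseteq X\times Y$, write $R[x]=\{y : xRy\}$, $R[S]=\bigcup_{x\in S}R[x]$, $R^{-1}[y]=\{x : xRy\}$, $R^{-1}[T]=\bigcup_{y\in T}R^{-1}[y]$, and for $S \subseteq X$, $T \subseteq Y$ put $\Diamond S = R[S]$ and $\Box T = \{x \in X \mid \forall y \in Y\,(xRy \Rightarrow y \in T)\}$. $S \subseteq X$ is $R$-closed if $\Box\Diamond S = S$; $T\subseteq Y$ is $R$-open if $\Diamond\Box T = T$. The induced quasi-orders are: on $X$, $x' \leq x$ iff $R[x'] \subseteq R[x]$; on $Y$, $y \leq y'$ iff $R^{-1}[y] \supseteq R^{-1}[y']$. Down-sets refer to these quasi-orders. A totally separated compact polarity (TSCP) is a tuple $(X,Y,R)$ with $X,Y$ compact topological spaces and $R \subseteq X \times Y$ such that: (i) the induced quasi-orders on $X$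 and $Y$ are partial orders; (ii) for each clopen down-set $U$ of $X$, $\Diamond U$ is clopen in $Y$, and for each clopen down-set $V$ of $Y$, $\Box V$ is clopen in $X$; (iii) for all $x\in X$, $y \in Y$ with $\neg(xRy)$ there are clopen sets $U \subseteq X$, $V \subseteq Y$ with $\Diamond U = V$, $\Box V = U$, $x \in U$ and $y \notin V$. A morphism of TSCPs from $(X_1,Y_1,R_1)$ to $(X_2,Y_2,R_2)$ is a pair $(s_X,s_Y)$ of continuous functions $s_X : X_1\to X_2$, $s_Y : Y_1 \to Y_2$ such that for all $x\in X_1$, $x'\in X_2$, $y \in Y_1$, $y' \in Y_2$: (forth) if $xR_1y$ then $s_X(x) R_2 s_Y(y)$; ($\Diamond$-back) if $x' R_2 s_Y(y)$, then there is $z \in X_1$ with $zR_1y$ and $s_X(z)\leq x'$; ($\Box$-back) if $s_X(x) R_2 y'$, then there is $w \in Y_1$ with $xR_1w$ and $y' \leq s_Y(w)$. Tightness: A clopen down-set $U \subseteq X$ is $R$-regular if for each $x \in X$ with $R[x]\neq R[\{x' \in X \mid x' < x\}]$, $R[x]\subseteq R[U]$ implies $x \in U$. A clopen down-set $V \subseteq Y$ is $R$-coregular if for each $y \in Y$ with $R^{-1}[y]\neq R^{-1}[\{y' \in Y \mid y' > y\}]$, $R^{-1}[y] \subseteq R^{-1}[V^c]$ implies $y \in V^c$, where $V^c = Y\setminus V$. A TSCP is tight if all $R$-regular clopen down-sets in $X$ are $R$-closed and all $R$-coregular clopen down-sets in $Y$ are $R$-open. $\mathbf{tTSCP}$ is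 the full subcategory of TSCPs (with morphisms the pairs $(s_X,s_Y)$ of continuous functions satisfying (forth), ($\Diamond$-back) and ($\Box$-back)) on the tight ones. *)

(* Defs.v *)
From mathcomp Require Import all_boot all_order finmap.
From mathcomp Require Import all_classical topology.

Set Implicit Arguments.
Unset Strict Implicit.
Unset Printing Implicit Defensive.

Import Order.TTheory.
Local Open Scope classical_set_scope.

(** * Categories *)

Record category := Category {
  obj :> Type;
  hom : obj -> obj -> Type;
  idm : forall a, hom a a;
  compm : forall a b c, hom b c -> hom a b -> hom a c;
  comp1m : forall a b (f : hom a b), compm (idm b) f = f;
  compm1 : forall a b (f : hom a b), compm f (idm a) = f;
  compA : forall a b c d (h : hom c d) (g : hom b c) (f : hom a b),
    compm h (compm g f) = compm (compm h g) f }.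

Arguments idm {_} _.

Definition opposite (C : category) : category :=
  @Category C (fun a b => hom b a) (@idm C) (fun a b c g f => compm f g)
    (fun a b => @compm1 C b a) (fun a b => @comp1m C b a)
    (fun a b c d h g f => esym (compA f g h)).

Definition full_subcategory (C : category) (P : C -> Prop) : category :=
  @Category {a : C | P a} (fun a b => hom (sval a) (sval b))
    (fun a => idm (sval a)) (fun a b c g f => compm g f)
    (fun a b => @comp1m C (sval a) (sval b))
    (fun a b => @compm1 C (sval a) (sval b))
    (fun a b c d => @compA C (sval a) (sval b) (sval c) (sval d)).

Record functor (C D : category) := Functor {
  fobj :> C -> D;
  fmap : forall a b, hom a b -> hom (fobj a) (fobj b);
  fmap1 : forall a, fmap (idm a) = idm (fobj a);
  fmapM : forall a b c (g : hom b c) (f : hom a b),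
    fmap (compm g f) = compm (fmap g) (fmap f) }.

Definition functor_id (C : category) : functor C C :=
  @Functor C C id (fun _ _ f => f) (fun=> erefl) (fun _ _ _ _ _ => erefl).

Definition functor_comp (C D E : category) (G : functor D E) (F : functor C D) :
    functor C E :=
  @Functor C E (G \o F) (fun a b f => fmap G (fmap F f))
    (fun a => etrans (congr1 (fmap G (b:=_)) (fmap1 F a)) (fmap1 G (F a)))
    (fun a b c g f =>
       etrans (congr1 (fmap G (b:=_)) (fmapM F g f)) (fmapM G _ _)).

Definition isomorphism (C : category) (a b : C) (f : hom a b) : Prop :=
  exists2 g : hom b a, compm g f = idm a & compm f g = idm b.

Record nat_trans (C D : category) (F G : functor C D) := NatTrans {
  component :> forall a, hom (F a) (G a);
  naturality : forall a b (f : hom a b),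
    compm (component b) (fmap F f) = compm (fmap G f) (component a) }.

Definition naturally_isomorphic (C D : category) (F G : functor C D) : Prop :=
  exists t : nat_trans F G, forall a, isomorphism (t a).

Definition equivalent (C D : category) : Prop :=
  exists (F : functor C D) (G : functor D C),
    naturally_isomorphic (functor_id C) (functor_comp G F) /\
    naturally_isomorphic (functor_comp F G) (functor_id D).

Definition dually_equivalent (C D : category) : Prop :=
  equivalent (opposite C) D.

(** * Bounded lattices and admissible homomorphisms *)

Section Admissible.
Local Open Scope order_scope.

Definition join_admissible d (L : tbLatticeType d) (M : {fset L}) : Prop :=
  forall a : L, a `&` \join_(m <- M) m = \join_(m <- M) (a `&` m).

Definition meet_admissible d (L : tbLatticeType d) (M : {fset L}) : Prop :=
  forall a : L, a `|` \meet_(m <- M) m = \meet_(m <- M) (a `|` m).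

(* [Order.TBLatticeMorphism] only asks for the bounds to be preserved, not for
   the binary operations, hence the explicit list of conditions. *)
Definition bounded_lattice_hom d (L : tbLatticeType d) d' (L' : tbLatticeType d')
    (f : L -> L') : Prop :=
  [/\ Order.meet_morphism f, Order.join_morphism f,
      f \bot = \bot & f \top = \top].

Definition admissible d (L : tbLatticeType d) d' (L' : tbLatticeType d')
    (f : L -> L') : Prop :=
  (forall M : {fset L}, join_admissible M ->
     join_admissible [fset f m | m in M]%fset) /\
  (forall M : {fset L}, meet_admissible M ->
     meet_admissible [fset f m | m in M]%fset).

End Admissible.

(* The display is a notational tag carrying no mathematical content. *)
Record bounded_lattice := BoundedLattice {
  lat_disp : Order.disp_t;
  lat_sort :> tbLatticeType lat_disp }.

Record admissible_hom (L L' : bounded_lattice) := AdmissibleHom {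
  admissible_fun :> L -> L';
  admissible_fun_hom : bounded_lattice_hom admissible_fun;
  admissible_fun_adm : admissible admissible_fun }.

Lemma admissible_hom_eq (L L' : bounded_lattice) (f g : admissible_hom L L') :
  f = g :> (L -> L') -> f = g.
Proof.
case: f g => [f fh fa] [g gh ga] /= fg; subst g.
by rewrite (Prop_irrelevance fh gh) (Prop_irrelevance fa ga).
Qed.

Lemma idfun_hom (L : bounded_lattice) : bounded_lattice_hom (@idfun L).
Proof. by split. Qed.

Lemma idfun_admissible (L : bounded_lattice) : admissible (@idfun L).
Proof.
have im (M : {fset L}) : [fset idfun m | m in M]%fset = M.
  by apply/fsetP=> x; apply/imfsetP/idP => [[y yM ->]//|xM]; exists x.
by split=> M; rewrite im.
Qed.

Lemma comp_hom (L1 L2 L3 : bounded_lattice)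
    (g : admissible_hom L2 L3) (f : admissible_hom L1 L2) :
  bounded_lattice_hom (g \o f).
Proof.
case: (admissible_fun_hom f) (admissible_fun_hom g) => fI fU f0 f1 [gI gU g0 g1].
by split=> [x y|x y||] /=; rewrite ?fI ?fU ?f0 ?f1 ?gI ?gU ?g0 ?g1.
Qed.

Lemma comp_admissible (L1 L2 L3 : bounded_lattice)
    (g : admissible_hom L2 L3) (f : admissible_hom L1 L2) :
  admissible (g \o f).
Proof.
have im (M : {fset L1}) : [fset (g \o f) m | m in M]%fset =
    [fset g n | n in [fset f m | m in M]%fset]%fset.
  apply/fsetP=> x; apply/imfsetP/imfsetP => [[y yM ->]|[_ /imfsetP[y yM ->] ->]].
    by exists (f y) => //; apply/imfsetP; exists y.
  by exists y.
case: (admissible_fun_adm g) (admissible_fun_adm f) => gj gm [fj fm].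
by split=> M MP; rewrite im; [apply/gj/fj|apply/gm/fm].
Qed.

Definition admissible_id (L : bounded_lattice) : admissible_hom L L :=
  AdmissibleHom (@idfun_hom L) (@idfun_admissible L).

Definition admissible_comp (L1 L2 L3 : bounded_lattice)
    (g : admissible_hom L2 L3) (f : admissible_hom L1 L2) :
    admissible_hom L1 L3 :=
  AdmissibleHom (comp_hom g f) (comp_admissible g f).

Definition La : category.
Proof.
apply: (@Category bounded_lattice admissible_hom admissible_id admissible_comp);
  by move=> *; exact: admissible_hom_eq.
Defined.

(** * Polarities *)

Section Polarity.
Variables (X Y : Type) (R : X -> Y -> Prop).

Definition rel_at (x : X) : set Y := [set y | R x y].
Definition rel_image (S : set X) : set Y := \bigcup_(x in S) rel_at x.
Definition inv_at (y : Y) : set X := [set x | R x y].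
Definition inv_image (T : set Y) : set X := \bigcup_(y in T) inv_at y.

Definition dia (S : set X) : set Y := rel_image S.
Definition box (T : set Y) : set X := [set x | forall y, R x y -> T y].

Definition rel_closed (S : set X) : Prop := box (dia S) = S.
Definition rel_open (T : set Y) : Prop := dia (box T) = T.

Definition leX (x' x : X) : Prop := rel_at x' `<=` rel_at x.
Definition leY (y y' : Y) : Prop := inv_at y' `<=` inv_at y.

Definition ltX (x' x : X) : Prop := leX x' x /\ x' <> x.
Definition ltY (y y' : Y) : Prop := leY y y' /\ y <> y'.

Definition downsetX (U : set X) : Prop := forall x' x, leX x' x -> U x -> U x'.
Definition downsetY (V : set Y) : Prop := forall y' y, leY y' y -> V y -> V y'.

End Polarity.

Definition antisym (T : Type) (le : T -> T -> Prop) : Prop :=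
  forall a b, le a b -> le b a -> a = b.

(* The induced quasi-orders are reflexive and transitive by construction, so
   they are partial orders iff they are antisymmetric. *)
Record is_tscp (X Y : topologicalType) (R : X -> Y -> Prop) : Prop := IsTscp {
  tscp_compactX : compact [set: X];
  tscp_compactY : compact [set: Y];
  tscp_antisymX : antisym (leX R);
  tscp_antisymY : antisym (leY R);
  tscp_dia : forall U, clopen U -> downsetX R U -> clopen (dia R U);
  tscp_box : forall V, clopen V -> downsetY R V -> clopen (box R V);
  tscp_sep : forall x y, ~ R x y ->
    exists (U : set X) (V : set Y),
      [/\ clopen U, clopen V, dia R U = V, box R V = U & U x /\ ~ V y] }.

Record tscp := Tscp {
  tscp_X : topologicalType;
  tscp_Y : topologicalType;
  tscp_R : tscp_X -> tscp_Y -> Prop;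
  tscpP : is_tscp tscp_R }.

Record is_tscp_hom (P1 P2 : tscp) (sX : tscp_X P1 -> tscp_X P2)
    (sY : tscp_Y P1 -> tscp_Y P2) : Prop := IsTscpHom {
  tscp_hom_contX : continuous sX;
  tscp_hom_contY : continuous sY;
  tscp_hom_forth : forall x y, tscp_R x y -> tscp_R (sX x) (sY y);
  tscp_hom_dia_back : forall x' y, tscp_R x' (sY y) ->
    exists2 z, tscp_R z y & leX (@tscp_R P2) (sX z) x';
  tscp_hom_box_back : forall x y', tscp_R (sX x) y' ->
    exists2 w, tscp_R x w & leY (@tscp_R P2) y' (sY w) }.

Record tscp_hom (P1 P2 : tscp) := TscpHom {
  hom_X : tscp_X P1 -> tscp_X P2;
  hom_Y : tscp_Y P1 -> tscp_Y P2;
  tscp_homP : is_tscp_hom hom_X hom_Y }.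

Lemma tscp_hom_eq (P1 P2 : tscp) (s t : tscp_hom P1 P2) :
  hom_X s = hom_X t -> hom_Y s = hom_Y t -> s = t.
Proof.
case: s t => [sX sY sP] [tX tY tP] /= eX eY; subst tX tY.
by rewrite (Prop_irrelevance sP tP).
Qed.

Lemma tscp_hom_homoX (P1 P2 : tscp) (s : tscp_hom P1 P2) x x' :
  leX (@tscp_R P1) x x' -> leX (@tscp_R P2) (hom_X s x) (hom_X s x').
Proof.
case: s => sX sY [/= _ _ forth _ boxb] xx' y' /boxb[w xw y'w].
by apply: y'w; apply/forth/xx'.
Qed.

Lemma tscp_hom_homoY (P1 P2 : tscp) (s : tscp_hom P1 P2) y y' :
  leY (@tscp_R P1) y y' -> leY (@tscp_R P2) (hom_Y s y) (hom_Y s y').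
Proof.
case: s => sX sY [/= _ _ forth diab _] yy' x' /diab[z zy zx'].
by apply: zx'; apply/forth/yy'.
Qed.

Lemma idfun_is_tscp_hom (P : tscp) :
  is_tscp_hom (@idfun (tscp_X P)) (@idfun (tscp_Y P)).
Proof.
split=> //; try by move=> ?; exact: cvg_id.
- by move=> x' y xy; exists x'.
- by move=> x y' xy; exists y'.
Qed.

Lemma comp_is_tscp_hom (P1 P2 P3 : tscp)
    (t : tscp_hom P2 P3) (s : tscp_hom P1 P2) :
  is_tscp_hom (hom_X t \o hom_X s) (hom_Y t \o hom_Y s).
Proof.
case: (tscp_homP s) (tscp_homP t) => cX cY f db bb [cX' cY' f' db' bb'].
split.
- by move=> x; apply: continuous_comp; [exact: cX|exact: cX'].
- by move=> y; apply: continuous_comp; [exact: cY|exact: cY'].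
- by move=> x y xy; apply/f'/f.
- move=> x y /db'[z' /db[z zy zz'] z'x]; exists z => //.
  by move=> u /(tscp_hom_homoX zz')/z'x.
- move=> x y /bb'[w' /bb[w xw w'w] yw']; exists w => //.
  by move=> u /(tscp_hom_homoY w'w)/yw'.
Qed.

Definition tscp_id (P : tscp) : tscp_hom P P :=
  TscpHom (idfun_is_tscp_hom P).

Definition tscp_comp (P1 P2 P3 : tscp) (t : tscp_hom P2 P3)
    (s : tscp_hom P1 P2) : tscp_hom P1 P3 :=
  TscpHom (comp_is_tscp_hom t s).

Definition TSCP : category.
Proof.
apply: (@Category tscp tscp_hom tscp_id tscp_comp);
  by move=> *; exact: tscp_hom_eq.
Defined.

(** * Tightness *)

Section Tight.
Variables (X Y : topologicalType) (R : X -> Y -> Prop).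

Definition rel_regular (U : set X) : Prop :=
  [/\ clopen U, downsetX R U &
    forall x, rel_at R x <> rel_image R [set x' | ltX R x' x] ->
      rel_at R x `<=` rel_image R U -> U x].

Definition rel_coregular (V : set Y) : Prop :=
  [/\ clopen V, downsetY R V &
    forall y, inv_at R y <> inv_image R [set y' | ltY R y y'] ->
      inv_at R y `<=` inv_image R (~` V) -> (~` V) y].

Definition rel_tight : Prop :=
  (forall U, rel_regular U -> rel_closed R U) /\
  (forall V, rel_coregular V -> rel_open R V).

End Tight.

Definition tight (P : TSCP) : Prop := rel_tight (@tscp_R P).

Definition tTSCP : category := full_subcategory tight.

(* Main.v *)
Require Import Defs.
From HB Require Import structures.
From mathcomp Require Import all_boot all_order finmap.
From mathcomp Require Import all_classical topology.

Set Implicit Arguments.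
Unset Strict Implicit.
Unset Printing Implicit Defensive.

(** Join- and meet-admissibility are visible on the topological side, and this
    is what makes the duality work.  A lattice [L] is sent to the polarity of
    its a-prime filters and a-prime ideals (those that admissible joins,
    respectively admissible meets, cannot enter without one of their members
    entering), related when disjoint; a polarity [P] is sent to the lattice of
    its clopen R-closed sets.

    Both constructions are instances of one notion.  A [presentation] of [P] by
    [L] is an order isomorphism [a |-> p a] from [L] onto the clopen R-closed
    subsets of [X].  Then [p] turns meets into intersections, [a |-> dia (p a)]
    turns joins into unions, and everything else about [L] and [P] follows:

    - In a tight polarity, [M] is join-admissible iff the union of the [p m] is
      R-closed, that is, equal to [p (\join M)]
      ([join_admissible_of_bigcup], [bigcup_of_join_admissible]).  The forward
      direction is exactly what tightness is for: the union over an admissible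
      family is always R-regular.
    - Hence the [a] with [x] in [p a] form an a-prime filter ([ext_prime]), and
      by compactness every a-prime filter arises from a unique point
      ([prime_realized], [ext_separates]).
    - Call [s : P1 -> P2] and [h : L2 -> L1] dual when
      [p1 (h a)] is the preimage of [p2 a] under the first component of [s].
      By the previous points every morphism of tight polarities is dual to
      exactly one admissible homomorphism, and conversely
      ([dual_pair_exists_admissible], [dual_pair_exists_hom]).

    Thus the categories are linked by a relation between objects (being
    presented by) over which morphisms correspond bijectively, and a formal
    argument ([equivalent_of_span]) turns this into an equivalence as soon as
    every lattice presents some tight polarity and every polarity is presented
    by some lattice.  The second is immediate; the first is the prime filter
    theorem [prime_filter_theorem] applied to the spectrum.

    Everything is symmetric under reversing [R] and dualising [L]: ideals of [L]
    are filters of [L^d], and a presentation of [P] by [L] gives one of the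
    transposed polarity by [L^d] ([dual_presentation]).  So
    the work is done on the [X] side, and transposition gives the [Y] side. *)

Import Order.TTheory.
Local Open Scope order_scope.
Local Open Scope classical_set_scope.

(** * Equivalences from full spans of objects *)

Section Span.
Context {C D : category} (S : C -> D -> Type)
  (m : forall a x b y, S a x -> S b y -> hom a b -> hom x y -> Prop).

(** The relation [S] plays the part of a functor whose value is only defined up
    to isomorphism; bijectivity of the correspondence [m] on morphisms is full
    faithfulness, and the first two fields are essential surjectivity on
    either side. *)
Record full_span : Type := FullSpan {
  span_left : forall a, {x : D & S a x};
  span_right : forall x, {a : C & S a x};
  span_id : forall a x (p : S a x), m p p (idm a) (idm x);
  span_comp : forall a x b y c z (p : S a x) (q : S b y) (r : S c z) f s g t,
    m p q f s -> m q r g t -> m p r (compm g f) (compm t s);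
  span_ex_right : forall a x b y (p : S a x) (q : S b y) f, exists s, m p q f s;
  span_ex_left : forall a x b y (p : S a x) (q : S b y) s, exists f, m p q f s;
  span_eq_right : forall a x b y (p : S a x) (q : S b y) f s t,
    m p q f s -> m p q f t -> s = t;
  span_eq_left : forall a x b y (p : S a x) (q : S b y) f g s,
    m p q f s -> m p q g s -> f = g }.

Variable E : full_span.

Let onC a b x y (p : S a x) (q : S b y) f : hom x y :=
  sval (cid (span_ex_right E p q f)).
Let onD a b x y (p : S a x) (q : S b y) s : hom a b :=
  sval (cid (span_ex_left E p q s)).

Let onCP a b x y (p : S a x) (q : S b y) f : m p q f (onC p q f).
Proof. by rewrite /onC; case: cid. Qed.
Let onDP a b x y (p : S a x) (q : S b y) s : m p q (onD p q s) s.
Proof. by rewrite /onD; case: cid. Qed.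

Let objD a := projT1 (span_left E a).
Let witD a : S a (objD a) := projT2 (span_left E a).
Let objC x := projT1 (span_right E x).
Let witC x : S (objC x) x := projT2 (span_right E x).

Let onC1 a : onC (witD a) (witD a) (idm a) = idm (objD a).
Proof. exact: (span_eq_right E (onCP _ _ _) (span_id E _)). Qed.

Let onCM a b c (g : hom b c) (f : hom a b) :
  onC (witD a) (witD c) (compm g f) =
  compm (onC (witD b) (witD c) g) (onC (witD a) (witD b) f).
Proof.
exact: (span_eq_right E (onCP _ _ _) (span_comp E (onCP _ _ _) (onCP _ _ _))).
Qed.

Let onD1 x : onD (witC x) (witC x) (idm x) = idm (objC x).
Proof. exact: (span_eq_left E (onDP _ _ _) (span_id E _)). Qed.

Let onDM x y z (t : hom y z) (s : hom x y) :
  onD (witC x) (witC z) (compm t s) =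
  compm (onD (witC y) (witC z) t) (onD (witC x) (witC y) s).
Proof.
exact: (span_eq_left E (onDP _ _ _) (span_comp E (onDP _ _ _) (onDP _ _ _))).
Qed.

Definition span_functor_right : functor C D := Functor onC1 onCM.
Definition span_functor_left : functor D C := Functor onD1 onDM.

Let iso_onD a b x (p : S a x) (q : S b x) : isomorphism (onD p q (idm x)).
Proof.
have inv c d (r : S c x) (t : S d x) :
    compm (onD t r (idm x)) (onD r t (idm x)) = idm c.
  have := span_comp E (onDP r t (idm x)) (onDP t r (idm x)).
  by rewrite comp1m => e; exact: (span_eq_left E e (span_id E _)).
by exists (onD q p (idm x)); exact: inv.
Qed.

Let iso_onC a x y (p : S a x) (q : S a y) : isomorphism (onC p q (idm a)).
Proof.
have inv z w (r : S a z) (t : S a w) :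
    compm (onC t r (idm a)) (onC r t (idm a)) = idm z.
  have := span_comp E (onCP r t (idm a)) (onCP t r (idm a)).
  by rewrite comp1m => e; exact: (span_eq_right E e (span_id E _)).
by exists (onC q p (idm a)); exact: inv.
Qed.

(** Choosing a partner for each object gives the object parts of the functors,
    and morphisms are transported along [m].  Any two partners of the same
    object are canonically isomorphic, through the morphism that corresponds to
    the identity; these isomorphisms are the components of the unit and counit.
    All equations hold because both sides correspond to the same morphism. *)
Lemma equivalent_of_span : equivalent C D.
Proof.
exists span_functor_right, span_functor_left; split.
- unshelve eexists.
    exists (fun a => onD (witD a) (witC (objD a)) (idm (objD a))) => a b f /=.
    have l := span_comp E (onCP (witD a) (witD b) f)
                (onDP (witD b) (witC (objD b)) (idm _)).
    have r := span_comp E (onDP (witD a) (witC (objD a)) (idm _))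
                (onDP (witC (objD a)) (witC (objD b))
                  (onC (witD a) (witD b) f)).
    by rewrite comp1m in l; rewrite compm1 in r; exact: (span_eq_left E l r).
  by move=> a; exact: iso_onD.
- unshelve eexists.
    exists (fun x => onC (witD (objC x)) (witC x) (idm (objC x))) => x y s /=.
    have l := span_comp E
                (onCP (witD (objC x)) (witD (objC y)) (onD (witC x) (witC y) s))
                (onCP (witD (objC y)) (witC y) (idm _)).
    have r := span_comp E (onCP (witD (objC x)) (witC x) (idm _))
                (onDP (witC x) (witC y) s).
    by rewrite comp1m in l; rewrite compm1 in r; exact: (span_eq_right E l r).
  by move=> x; exact: iso_onC.
Qed.

End Span.

(** * Polarities and their transposes *)

Section PolarityTheory.
Context (X Y : Type) (R : X -> Y -> Prop).

(** The Galois connection from which the other properties of [dia] and [box]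
    are derived. *)
Lemma dia_sub S T : (dia R S `<=` T) <-> (S `<=` box R T).
Proof.
split=> [ST x Sx y xy|ST y [x Sx xy]]; first by apply: ST; exists x.
exact: ST xy.
Qed.

Lemma sub_box_dia S : S `<=` box R (dia R S).
Proof. exact/dia_sub. Qed.

Lemma dia_box_sub T : dia R (box R T) `<=` T.
Proof. exact/dia_sub. Qed.

Lemma dia_mono S S' : S `<=` S' -> dia R S `<=` dia R S'.
Proof. by move=> SS' y [x /SS' Sx xy]; exists x. Qed.

Lemma box_mono T T' : T `<=` T' -> box R T `<=` box R T'.
Proof. by move=> TT' x Tx y /Tx/TT'. Qed.

Lemma box_dia_box T : box R (dia R (box R T)) = box R T.
Proof.
apply/seteqP; split; last exact: sub_box_dia.
exact: box_mono (@dia_box_sub T).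
Qed.

Lemma dia_bigcup I (D : set I) (S : I -> set X) :
  dia R (\bigcup_(i in D) S i) = \bigcup_(i in D) dia R (S i).
Proof.
apply/seteqP; split=> [y [x [i Di Six] xy]|y [i Di [x Six xy]]].
  by exists i => //; exists x.
by exists x => //; exists i.
Qed.

Lemma downset_dia S : downsetY R (dia R S).
Proof. by move=> y' y y'y [x Sx xy]; exists x => //; exact: y'y. Qed.

Lemma downset_box T : downsetX R (box R T).
Proof. by move=> x' x x'x Tx y /x'x; exact: Tx. Qed.

End PolarityTheory.

Section Transpose.
Context {X Y : Type}.

Definition flip (R : X -> Y -> Prop) : Y -> X -> Prop := fun y x => R x y.

Context (R : X -> Y -> Prop).

Lemma dia_flip T : dia (flip R) T = ~` box R (~` T).
Proof.
apply/seteqP; split=> [x [y Ty xy] /(_ _ xy)//|x nx].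
by apply: contrapT => nd; apply: nx => y xy Ty; apply: nd; exists y.
Qed.

Lemma box_flip S : box (flip R) S = ~` dia R (~` S).
Proof.
apply/seteqP; split=> [y Sy [x nSx /Sy]//|y ny x xy].
by apply: contrapT => nSx; apply: ny; exists x.
Qed.

Lemma rel_closed_flip T : rel_closed (flip R) T <-> rel_open R (~` T).
Proof.
rewrite /rel_closed /rel_open box_flip dia_flip setCK.
by split=> [/(congr1 setC)|->]; rewrite !setCK.
Qed.

End Transpose.

Lemma clopen_setC (T : topologicalType) (A : set T) : clopen A -> clopen (~` A).
Proof. exact: (clopenC A). Qed.

Section TransposeTop.
Context {X Y : topologicalType} (R : X -> Y -> Prop).

(** Transposition reverses both induced orders and exchanges a set with its
    complement, so that the conditions on [dia] and [box] trade places. *)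
Lemma is_tscp_flip : is_tscp R -> is_tscp (flip R).
Proof.
case=> cX cY aX aY cd cb sep; split=> //.
- by move=> y y' yy' y'y; exact: aY.
- by move=> x x' xx' x'x; exact: aX.
- move=> V cV dV; rewrite dia_flip; apply: clopen_setC.
  apply: cb; first exact: clopen_setC.
  by move=> y y' yy' nVy Vy; apply: nVy; exact: dV Vy.
- move=> U cU dU; rewrite box_flip; apply: clopen_setC.
  apply: cd; first exact: clopen_setC.
  by move=> x x' xx' nUx Ux; apply: nUx; exact: dU Ux.
- move=> y x /sep[U [V [cU cV UV VU [Ux nVy]]]].
  exists (~` V), (~` U); split; try exact: clopen_setC.
  + by rewrite dia_flip setCK VU.
  + by rewrite box_flip setCK UV.
  + by split=> //; exact.
Qed.

(** The half of tightness that speaks of [X]; the other half is the same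
    condition on the transposed polarity, see [rel_tightE]. *)
Definition half_tight := forall U, rel_regular R U -> rel_closed R U.

End TransposeTop.

Lemma half_tight_flip (X Y : topologicalType) (R : X -> Y -> Prop) :
  half_tight (flip R) <-> forall V, rel_coregular R V -> rel_open R V.
Proof.
have flt y : [set y' | ltX (flip R) y' y] = [set y' | ltY R y y'].
  by apply/seteqP; split=> y' [le ne]; split=> // /esym.
have clE V : rel_closed (flip R) (~` V) <-> rel_open R V.
  by rewrite rel_closed_flip setCK.
have regE V : rel_regular (flip R) (~` V) <-> rel_coregular R V.
  split=> -[cV dV rV]; split.
  - by rewrite -[V]setCK; exact: clopen_setC.
  - move=> y' y y'y Vy; apply: contrapT => nVy'; exact: (dV _ _ y'y nVy' Vy).
  - by move=> y ne sub; apply: rV => //; rewrite flt.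
  - exact: clopen_setC.
  - by move=> y' y y'y nVy Vy'; apply: nVy; exact: dV Vy'.
  - by move=> y; rewrite flt => ne sub; apply: rV.
split=> [ht V /regE/ht/clE//|co U]; rewrite -[U]setCK.
by move=> /regE/co/clE.
Qed.

Lemma rel_tightE (X Y : topologicalType) (R : X -> Y -> Prop) :
  rel_tight R <-> half_tight R /\ half_tight (flip R).
Proof. by rewrite half_tight_flip. Qed.

Definition transpose (P : tscp) : tscp := Tscp (is_tscp_flip (tscpP P)).

Lemma tscp_hom_flip (P1 P2 : tscp) (s : tscp_hom P1 P2) :
  @is_tscp_hom (transpose P1) (transpose P2) (hom_Y s) (hom_X s).
Proof.
case: s => sX sY [cX cY f db bb]; split=> //=.
- by move=> y x /f.
- by move=> y' x /bb[w xw y'w]; exists w.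
- by move=> y x' /db[z zy zx']; exists z.
Qed.

Definition transpose_hom (P1 P2 : tscp) (s : tscp_hom P1 P2) :
  tscp_hom (transpose P1) (transpose P2) := TscpHom (tscp_hom_flip s).

(** * A-prime filters *)

Section Filters.
Context {d} {L : tbLatticeType d}.
Implicit Types (a b c : L) (F I : set L).

(** Ideals are not defined separately: an ideal of [L] is a filter of [L^d]. *)
Definition lfilter F : Prop :=
  [/\ F \top, forall a b, F a -> F b -> F (a `&` b)%O &
      forall a b, (a <= b)%O -> F a -> F b].

(** Since the empty family is join-admissible, the second condition also makes
    a-prime filters proper. *)
Definition prime_lfilter F : Prop :=
  lfilter F /\ forall M : {fset L}, join_admissible M ->
    F (\join_(m <- M) m)%O -> exists2 m, m \in M & F m.

Lemma lfilter_bigcup (C : set (set L)) : C !=set0 -> total_on C subset ->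
  C `<=` lfilter -> lfilter (\bigcup_(F in C) F).
Proof.
move=> [F0 C0] tot sub; split.
- by exists F0 => //; case: (sub _ C0).
- move=> a b [F CF Fa] [G CG Gb]; have [FG|GF] := tot _ _ CF CG.
    by exists G => //; case: (sub _ CG) => _ GI _; apply: GI => //; exact: FG.
  by exists F => //; case: (sub _ CF) => _ FI _; apply: FI => //; exact: GF.
- move=> a b ab [F CF Fa]; exists F => //.
  by case: (sub _ CF) => _ _ Fle; exact: Fle Fa.
Qed.

Lemma lfilter_up a : lfilter [set b | (a <= b)%O].
Proof.
split=> /= [|b c ab ac|b c bc ab]; first exact: lex1.
- by rewrite lexI ab.
- exact: le_trans bc.
Qed.

Lemma lfilter_adjoin F a : lfilter F ->
  lfilter [set b | exists2 c, F c & (c `&` a <= b)%O].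
Proof.
move=> [F1 FI Fle]; split=> /=.
- by exists \top%O; rewrite ?lex1.
- move=> b b' [c Fc cb] [c' Fc' cb']; exists (c `&` c')%O; first exact: FI.
  rewrite lexI (le_trans _ cb) ?(le_trans _ cb') //.
    by apply: leI2 => //; exact: leIr.
  by apply: leI2 => //; exact: leIl.
- by move=> b b' bb' [c Fc cb]; exists c => //; exact: le_trans bb'.
Qed.

End Filters.

(** The ideal [I] appears as a filter of [L^d].  A filter [G] that is maximal
    among those disjoint from [I] is a-prime: if no member of an admissible
    family [M] is in [G], maximality puts some [c `&` m] with [c] in [G] into
    [I], with the same [c] for all [m]; admissibility then gives
    [c `&` \join M = \join (c `&` m)], which is in [I], so that [\join M] is
    not in [G].  Maximality is part of the conclusion because tightness of the
    spectrum depends on it. *)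
Lemma prime_filter_theorem d (L : tbLatticeType d) (F I : set L) :
  lfilter F -> @lfilter _ L^d I -> (forall a, F a -> ~ I a) ->
  exists G, [/\ prime_lfilter G, F `<=` G, forall a, G a -> ~ I a &
    forall H, lfilter H -> G `<=` H -> (forall a, H a -> ~ I a) -> H `<=` G].
Proof.
move=> fF [I0 IU Ile] FI.
(* Adding [F] to [A] makes the empty chain harmless in Zorn's lemma. *)
pose P (A : set L) := lfilter (F `|` A) /\ forall a, (F `|` A) a -> ~ I a.
have [C CP Ctot|A [[fA AI] Amax]] := @Zorn_bigcup _ P.
  have [C0|/set0P/negP/negPn/eqP->] := pselect (C !=set0); last first.
    by rewrite /P bigcup_set0 setU0.
  split; last first.
    move=> a [|[A CA Aa]]; first exact: FI.
    by apply: (CP _ CA).2; right.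
  have -> : F `|` \bigcup_(X in C) X = \bigcup_(X in [set F `|` A | A in C]) X.
    apply/seteqP; split=> [a [Fa|[A CA Aa]]|a [_ [A CA <-] [Fa|Aa]]].
    - by case: C0 => A CA; exists (F `|` A); [exists A|left].
    - by exists (F `|` A); [exists A|right].
    - by left.
    - by right; exists A.
  apply: lfilter_bigcup.
  - by case: C0 => A CA; exists (F `|` A), A.
  - move=> _ _ [A CA <-] [B CB <-].
    by have [AB|BA] := Ctot _ _ CA CB; [left|right]; exact: setUS.
  - by move=> _ [A CA <-]; exact: (CP _ CA).1.
set G := F `|` A in fA AI.
have Gmax H : lfilter H -> G `<=` H -> (forall a, H a -> ~ I a) -> H `<=` G.
  move=> fH GH HI; apply: contrapT => nHG.
  have FH : F `|` H = H by apply/setUidPr => a Fa; apply: GH; left.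
  apply: (Amax H); last by rewrite /P FH.
  split; first by move=> a Aa; apply: GH; right.
  by move=> HA; apply: nHG => a /HA; right.
exists G; split=> //; last by move=> a; left.
case: (fA) => G1 GI Gle; split=> // M admM GM; apply: contrapT => nGM.
have {nGM}mI m : m \in M -> exists2 c, G c & I (c `&` m)%O.
  move=> mM; apply: contrapT => nI; apply: nGM; exists m => //.
  apply: (Gmax _ (lfilter_adjoin m fA)).
  - by move=> a Ga; exists a => //; exact: leIl.
  - by move=> a [c Gc ca] Ia; apply: nI; exists c => //; exact: Ile Ia.
  - by exists \top%O => //; exact: leIr.
have [c Gc cI] : exists2 c, G c & forall m, m \in M -> I (c `&` m)%O.
  suff : forall s : seq L, {subset s <= M} ->
    exists2 c, G c & forall m, m \in s -> I (c `&` m)%O by apply.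
  elim=> [|m s IH] sM; first by exists \top%O.
  have [|c Gc cI] := IH; first by move=> n ns; apply: sM; rewrite inE ns orbT.
  have [|c' Gc' cI'] := mI m; first by apply: sM; rewrite mem_head.
  exists (c `&` c')%O; first exact: GI.
  move=> n; rewrite inE => /orP[/eqP->|ns].
    by apply: Ile cI'; apply: leI2 => //; exact: leIr.
  by apply: Ile (cI _ ns); apply: leI2 => //; exact: leIl.
have : I (c `&` \join_(m <- M) m)%O.
  rewrite admM big_seq; exact: (big_ind I).
by apply: AI; exact: GI.
Qed.

(** * Presentations of a polarity by a lattice *)

Lemma compact_directed (X : topologicalType) I (D : set I) (C : I -> set X) :
  compact [set: X] -> D !=set0 ->
  (forall i j, D i -> D j -> exists2 k, D k & C k `<=` C i `&` C j) ->
  (forall i, D i -> closed (C i)) -> (forall i, D i -> C i !=set0) ->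
  exists x, forall i, D i -> C i x.
Proof.
move=> cX D0 dir cl ne.
have FF := filter_from_filter D0 dir.
have PF := filter_from_proper FF ne.
have [x [_ clx]] := cX _ PF filterT.
exists x => i Di; apply: cl => // V Vx; apply: clx => //.
by exists i.
Qed.

Lemma clopen_fset_bigcup (X : topologicalType) (I : choiceType) (M : {fset I})
    (U : I -> set X) :
  (forall i, clopen (U i)) -> clopen (\bigcup_(i in [set` M]) U i).
Proof.
move=> cU; split; first by apply: bigcup_open => i _; case: (cU i).
by apply: closed_bigcup => // i _; case: (cU i).
Qed.

(** What it takes to identify [L] with the lattice of clopen R-closed sets of
    [P] whatever the carrier of [L] is, so that abstract lattices, lattices of
    sets and their duals are treated alike. *)
Record presentation d (L : tbLatticeType d) (P : tscp) := Presentation {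
  ext :> L -> set (tscp_X P);
  ext_clopen : forall a, clopen (ext a);
  ext_closed : forall a, rel_closed (@tscp_R P) (ext a);
  ext_le : forall a b, ext a `<=` ext b <-> (a <= b)%O;
  ext_surj : forall U, clopen U -> rel_closed (@tscp_R P) U ->
    exists a, ext a = U }.

(** The extension of [a] on the [Y] side.  By the Galois connection, [ext] and
    [coext] determine each other. *)
Definition coext d (L : tbLatticeType d) P (p : presentation L P) (a : L) :
  set (tscp_Y P) := dia (@tscp_R P) (p a).

Section PresentationTheory.
Context {d} {L : tbLatticeType d} {P : tscp} (p : presentation L P).
Local Notation R := (@tscp_R P).
Implicit Types (a b : L) (x : tscp_X P) (y : tscp_Y P) (M : {fset L}).

Lemma ext_mono a b : (a <= b)%O -> p a `<=` p b.
Proof. by move/ext_le. Qed.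

Lemma ext_inj : injective p.
Proof.
move=> a b e; apply: le_anti; apply/andP.
by split; apply/(ext_le p); rewrite e.
Qed.

Lemma box_coext a : box R (coext p a) = p a.
Proof. exact: ext_closed. Qed.

Lemma coext_le a b : coext p a `<=` coext p b <-> (a <= b)%O.
Proof.
split=> [ab|/ext_mono]; last exact: dia_mono.
by apply/(ext_le p); rewrite -box_coext -[p b]box_coext; exact: box_mono.
Qed.

Lemma coext_inj : injective (coext p).
Proof.
move=> a b e; apply: le_anti; apply/andP.
by split; apply/coext_le; rewrite e.
Qed.

Lemma downset_ext a : downsetX R (p a).
Proof. by rewrite -box_coext; exact: downset_box. Qed.

Lemma clopen_coext a : clopen (coext p a).
Proof.
by apply: (tscp_dia (tscpP P)); [exact: ext_clopen|exact: downset_ext].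
Qed.

Lemma ext_top : p \top = setT.
Proof.
apply/seteqP; split=> // x _.
have cT : rel_closed R setT by apply/seteqP; split=> // ? _; exact: sub_box_dia.
by have [a pa] := ext_surj p clopenT cT; apply: (ext_mono (lex1 a)); rewrite pa.
Qed.

Lemma ext_meet a b : p (a `&` b)%O = p a `&` p b.
Proof.
apply/seteqP; split=> [x pab|x pab].
  by split; apply: ext_mono pab; [exact: leIl|exact: leIr].
have cI : rel_closed R (p a `&` p b).
  apply/seteqP; split=> [z zab|]; last exact: sub_box_dia.
  split; [rewrite -(ext_closed p a)|rewrite -(ext_closed p b)];
    by apply: box_mono zab; apply: dia_mono => ? [].
have [c pc] := ext_surj p (clopenI (ext_clopen p a) (ext_clopen p b)) cI.
rewrite -pc in pab; apply: ext_mono pab.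
by rewrite lexI; apply/andP; split; apply/(ext_le p); rewrite pc => ? [].
Qed.

(** The two sets provided by separation form a pair [(p a, coext p a)]. *)
Lemma presentation_sep x y : ~ R x y -> exists2 a, p a x & ~ coext p a y.
Proof.
move=> /(tscp_sep (tscpP P))[U [V [cU _ UV VU [Ux nVy]]]].
have [|a pa] := ext_surj p cU; first by rewrite /rel_closed UV.
by exists a; rewrite /coext pa ?UV.
Qed.

Lemma leX_ext x' x : leX R x' x <-> forall a, p a x -> p a x'.
Proof.
split=> [le a|h y x'y]; first exact: downset_ext.
apply: contrapT => /presentation_sep[a /h px' []].
by exists x'.
Qed.

Lemma ext_separates x x' : (forall a, p a x <-> p a x') -> x = x'.
Proof.
by move=> e; apply: (tscp_antisymX (tscpP P)); apply/leX_ext => a; apply e.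
Qed.

(** Separation exhibits [inv_at R y] as an intersection of clopen sets. *)
Lemma closed_inv_at y : closed (inv_at R y).
Proof.
have -> : inv_at R y = \bigcap_(a in [set a | ~ coext p a y]) ~` p a.
  apply/seteqP; split=> [x xy a nay pax|x h]; first by apply: nay; exists x.
  by apply: contrapT => /presentation_sep[a pax nay]; exact: h nay pax.
by apply: closed_bigI => a _; apply: open_closedC; case: (ext_clopen p a).
Qed.

(** Intersection distributes over unions, and when the union of the [p m] is
    already [p] of the join nothing is added by closing it up. *)
Lemma join_admissible_of_bigcup M :
  p (\join_(m <- M) m)%O `<=` \bigcup_(m in [set` M]) p m -> join_admissible M.
Proof.
move=> sub a; apply: le_anti; apply/andP; split; last first.
  apply/joinsP_seq => m mM _.
  by rewrite lexI leIl /=; apply: leIxr; exact: joins_sup_seq.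
apply/(ext_le p); rewrite ext_meet => x [pax /sub[m mM pmx]].
have : p (a `&` m)%O x by rewrite ext_meet.
by apply: ext_mono; exact: (joins_sup_seq (fun m => a `&` m)%O).
Qed.

Lemma bigcup_ext_sub M :
  \bigcup_(m in [set` M]) p m `<=` p (\join_(m <- M) m)%O.
Proof. by move=> x [m mM pmx]; apply: ext_mono pmx; exact: joins_sup_seq. Qed.

Lemma presentation_hausdorff : hausdorff_space (tscp_X P).
Proof.
move=> x x' cl; apply: ext_separates => a.
have nb z : (p a z -> nbhs z (p a)) /\ (~ p a z -> nbhs z (~` p a)).
  case: (ext_clopen p a) => oa ca; split=> h; apply: open_nbhs_nbhs; split=> //.
  exact: closed_openC.
split=> h; apply: contrapT => h'.
  by have [z []] := cl _ _ ((nb x).1 h) ((nb x').2 h').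
by have [z []] := cl _ _ ((nb x).2 h') ((nb x').1 h).
Qed.

(** The topology of [X] is generated by the sets [p a] and their complements:
    these separate points, and a compact Hausdorff topology has no strictly
    coarser Hausdorff topology.  The lemma says this in terms of limits, which
    is the form used for continuity. *)
Lemma cvg_ext (F : set_system (tscp_X P)) x : ProperFilter F ->
  (forall a, p a x -> F (p a)) -> (forall a, ~ p a x -> F (~` p a)) -> F --> x.
Proof.
move=> PF Fp FnP; have cX := tscp_compactX (tscpP P).
have clx z : cluster F z -> z = x.
  move=> clz; apply: esym; apply: ext_separates => a.
  case: (ext_clopen p a) => oa ca.
  have cla : closed (~` p a) by exact: open_closedC.
  split=> h; apply: contrapT => h'.
    have : closure (p a) z by move=> V Vz; apply: clz => //; exact: Fp.
    by move/ca.
  have : closure (~` p a) z by move=> V Vz; apply: clz => //; exact: FnP.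
  by move/cla; apply.
have clE : cluster F = [set x].
  apply/seteqP; split=> [z /clx//|_ ->].
  by have [z [_ clz]] := cX _ PF filterT; rewrite -(clx _ clz).
exact: (compact_cluster_set1 presentation_hausdorff cX filterT PF filterT clE).
Qed.

End PresentationTheory.

Section Dual.
Context {d} {L : tbLatticeType d} {P : tscp} (p : presentation L P).

Lemma dual_ext_clopen a : clopen (~` coext p a).
Proof. exact/clopen_setC/clopen_coext. Qed.

Lemma dual_ext_closed a : rel_closed (@tscp_R (transpose P)) (~` coext p a).
Proof.
apply: (rel_closed_flip (@tscp_R P) _).2; rewrite setCK.
by rewrite /rel_open box_coext.
Qed.

Lemma dual_ext_le (a b : L^d) :
  ~` coext p a `<=` ~` coext p b <-> (a <= b)%O.
Proof. by rewrite leEdual -(coext_le p) setCS. Qed.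

Lemma dual_ext_surj V : clopen V -> rel_closed (@tscp_R (transpose P)) V ->
  exists a, ~` coext p a = V.
Proof.
move=> cV /(rel_closed_flip (@tscp_R P)) oV.
have cU : clopen (box (@tscp_R P) (~` V)).
  apply: (tscp_box (tscpP P)); first exact: clopen_setC.
  by rewrite -oV; exact: downset_dia.
have [a pa] := ext_surj p cU (box_dia_box _ _).
by exists a; rewrite /coext pa oV setCK.
Qed.

(** The transposed polarity is presented by the dual lattice, through
    complements of the sets [coext p a]. *)
Definition dual_presentation : presentation L^d (transpose P) :=
  @Presentation _ L^d (transpose P) (fun a => ~` coext p a)
    dual_ext_clopen dual_ext_closed dual_ext_le dual_ext_surj.

Lemma dual_coext a : coext dual_presentation a = ~` p a.
Proof. by rewrite /coext dia_flip setCK box_coext. Qed.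

(** This is [ext_meet] for the dual presentation. *)
Lemma coext_join a b : coext p (a `|` b)%O = coext p a `|` coext p b.
Proof.
by have := ext_meet dual_presentation a b; rewrite -setCU => /setC_inj.
Qed.

Lemma coext_bot : coext p \bot = set0.
Proof. by have := ext_top dual_presentation; rewrite -setC0 => /setC_inj. Qed.

Lemma coext_joins (I : eqType) (s : seq I) (f : I -> L) :
  coext p (\join_(i <- s) f i)%O = \bigcup_(i in [set` s]) coext p (f i).
Proof.
elim: s => [|i s IH].
  rewrite big_nil coext_bot; apply/seteqP; split=> // y [i] /=.
  by rewrite in_nil.
rewrite big_cons coext_join IH; apply/seteqP; split=> [y []|y [k]] /=.
- by exists i => //=; rewrite mem_head.
- by case=> k ks ky; exists k => //=; rewrite inE ks orbT.
- by rewrite inE => /orP[/eqP->|ks] ky; [left|right; exists k].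
Qed.

End Dual.

(** * Points as a-prime filters *)

Section Points.
Context {d} {L : tbLatticeType d} {P : tscp} (p : presentation L P).
Local Notation R := (@tscp_R P).
Implicit Types (a b : L) (x : tscp_X P) (y : tscp_Y P) (M : {fset L}).

Lemma ext_filter_meets (F : set L) (C : set (tscp_X P)) :
  F \top -> (forall a b, F a -> F b -> F (a `&` b)%O) -> closed C ->
  (forall a, F a -> (p a `&` C) !=set0) ->
  exists2 x, C x & forall a, F a -> p a x.
Proof.
move=> F1 FI cC ne.
have [|a b Fa Fb|a Fa||x hx] := @compact_directed _ _ F (fun a => p a `&` C)
  (tscp_compactX (tscpP P)); last first.
- by exists x => [|a /hx[]//]; case: (hx _ F1).
- exact: ne.
- by apply: closedI => //; case: (ext_clopen p a).
- by exists (a `&` b)%O; [exact: FI|rewrite ext_meet => z [[? ?] ?]].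
- by exists \top%O.
Qed.

(** By tightness it is enough to show that the union [U] is R-regular.  Let [x]
    lie in the closure [p (\join M)] of [U] but not in [U], and let [y] be
    related to [x].  For every [a] with [x] in [p a], admissibility yields
    [m] in [M] and a point of [p a `&` p m] related to [y]; by compactness a
    single [x'] in [U] works for all [a].  Then [x' <= x], and [x' <> x] because
    [x] is not in [U].  So [y] is related to a point strictly below [x], and the
    condition of R-regularity does not apply to [x]. *)
Lemma bigcup_of_join_admissible M : half_tight R -> join_admissible M ->
  p (\join_(m <- M) m)%O = \bigcup_(m in [set` M]) p m.
Proof.
move=> ht admM; set U := \bigcup_(_ in _) _.
have diaU : dia R U = coext p (\join_(m <- M) m)%O.
  by rewrite coext_joins dia_bigcup.
have cU : clopen U by apply: clopen_fset_bigcup => a; exact: ext_clopen.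
suff <- : box R (dia R U) = U by rewrite diaU box_coext.
apply: ht; split=> // [x' x x'x [m mM pmx]|x ne sub].
  by exists m => //; exact: downset_ext pmx.
apply: contrapT => nUx; apply: ne.
apply/seteqP; split=> [y xy|y [x' [x'x _] /x'x]//].
have {}sub : p (\join_(m <- M) m)%O x by rewrite -box_coext -diaU.
have [||||x' [x'y [m mM pmx']] px'] :=
    @ext_filter_meets [set a | p a x] (inv_at R y `&` U).
- by rewrite /= ext_top.
- by move=> a b pa pb /=; rewrite ext_meet.
- by apply: closedI; [exact: (closed_inv_at p)|case: cU].
- move=> a pax.
  have : coext p (a `&` \join_(m <- M) m)%O y.
    by exists x; rewrite ?ext_meet.
  rewrite admM coext_joins => -[m mM [z + zy]].
  by rewrite ext_meet => -[paz pmz]; exists z; split=> //; split=> //; exists m.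
exists x' => //; split; first exact/(leX_ext p).
by move=> xx'; apply: nUx; rewrite -xx'; exists m.
Qed.

Lemma ext_prime x : half_tight R -> prime_lfilter [set a | p a x].
Proof.
move=> ht; split=> /= [|M admM]; last first.
  by rewrite bigcup_of_join_admissible // => -[m mM pmx]; exists m.
split=> /= [|a b pa pb|a b ab].
- by rewrite ext_top.
- by rewrite ext_meet.
- exact: ext_mono.
Qed.

(** A point with trace [F] belongs to all [p a] with [a] in [F] and to no [p b]
    with [b] outside [F].  By compactness it exists unless some [p a] is covered
    by finitely many [p m] with [m] outside [F].  In that case the elements
    [a `&` m] form an admissible family with join [a], so one of them is in [F]
    by a-primeness, and then so is [m]. *)
Lemma prime_realized (F : set L) : prime_lfilter F ->
  exists x, forall a, F a <-> p a x.
Proof.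
case=> -[F1 FI Fle] Fp.
(* An index is an element of [F] with a finite set of elements outside [F]. *)
pose C (i : L * {fset L}) := p i.1 `&` \bigcap_(m in [set` i.2]) ~` p m.
pose D := [set i : L * {fset L} | F i.1 /\ forall m, m \in i.2 -> ~ F m].
have [|i j|i _|i Di|x hx] :=
    @compact_directed _ _ D C (tscp_compactX (tscpP P)).
- by exists (\top%O, fset0).
- move=> [Fi ni] [Fj nj]; exists ((i.1 `&` j.1)%O, (i.2 `|` j.2)%fset).
    split=> [|m]; first exact: FI.
    by rewrite inE => /orP[/ni|/nj].
  rewrite /C ext_meet => z [[pi pj] h].
  by split; split=> // m mi; apply: h; rewrite /= inE mi ?orbT.
- apply: closedI; first by case: (ext_clopen p i.1).
  by apply: closed_bigI => m _; apply: open_closedC; case: (ext_clopen p m).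
- case: i Di => a M [/= Fa nM]; apply: contrapT => C0.
  have sub z : p a z -> exists2 m, m \in M & p m z.
    move=> paz; apply: contrapT => nz; apply: C0; exists z; split=> // m mM pmz.
    by apply: nz; exists m.
  pose N := [fset (a `&` m)%O | m in M]%fset.
  have Na z : p a z -> (\bigcup_(n in [set` N]) p n) z.
    move=> paz; have [m mM pmz] := sub _ paz.
    exists (a `&` m)%O; last by rewrite ext_meet.
    by rewrite /=; apply/imfsetP; exists m.
  have [||n /imfsetP[/= m mM ->]] := Fp N.
  + apply: join_admissible_of_bigcup => z.
    have Nle : (\join_(n <- N) n <= a)%O.
      by apply/joinsP_seq => n /imfsetP[m _ ->] _; exact: leIl.
    by move/(ext_mono Nle)/Na.
  + apply: Fle Fa; apply/(ext_le p) => z /Na; exact: bigcup_ext_sub.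
  + by move=> /(Fle _ _ (leIr _ _)); exact: nM.
exists x => a; split=> [Fa|pax].
  by have [] := hx (a, fset0); first by split.
apply: contrapT => nFa.
have [|_ /(_ a) nax] := hx (\top%O, [fset a]%fset).
  by split=> // m /fset1P->.
by apply: nax pax; rewrite /= inE.
Qed.

End Points.

(** * Dual pairs of morphisms *)

Section HomPreimage.
Context {P1 P2 : tscp} (s : tscp_hom P1 P2).
Local Notation R1 := (@tscp_R P1).
Local Notation R2 := (@tscp_R P2).

(** Together with [box_preimage], this is how the forth and back
    conditions are used to get from [s] to a lattice homomorphism: preimages
    commute with [dia] and [box]. *)
Lemma dia_preimage U : downsetX R2 U ->
  dia R1 (hom_X s @^-1` U) = hom_Y s @^-1` dia R2 U.
Proof.
case: s => sX sY [_ _ /= forth diab _] dU; apply/seteqP; split=> y /=.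
  by move=> [x Ux xy]; exists (sX x) => //; exact: forth.
move=> [x' Ux' /diab[z zy zx']]; exists z => //.
exact: dU Ux'.
Qed.

Lemma box_preimage V : downsetY R2 V ->
  box R1 (hom_Y s @^-1` V) = hom_X s @^-1` box R2 V.
Proof.
case: s => sX sY [_ _ /= forth _ boxb] dV; apply/seteqP; split=> x /= h y.
  by move=> /boxb[w xw yw]; apply: dV yw _; exact: h.
by move=> xy; apply: h; exact: forth.
Qed.

End HomPreimage.

Definition dual_pair d1 (L1 : tbLatticeType d1) d2 (L2 : tbLatticeType d2) P1 P2
    (p1 : presentation L1 P1) (p2 : presentation L2 P2)
    (s : tscp_hom P1 P2) (h : L2 -> L1) : Prop :=
  forall a, p1 (h a) = hom_X s @^-1` p2 a.

Section DualPair.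
Context {d1} {L1 : tbLatticeType d1} {d2} {L2 : tbLatticeType d2} {P1 P2 : tscp}
  (p1 : presentation L1 P1) (p2 : presentation L2 P2).
Implicit Types (s : tscp_hom P1 P2) (h : L2 -> L1).

Lemma dual_pair_coext s h : dual_pair p1 p2 s h ->
  forall a, coext p1 (h a) = hom_Y s @^-1` coext p2 a.
Proof.
by move=> sh a; rewrite /coext sh dia_preimage //; exact: downset_ext.
Qed.

Lemma dual_pair_transpose s h : dual_pair p1 p2 s h ->
  dual_pair (dual_presentation p1) (dual_presentation p2) (transpose_hom s) h.
Proof. by move=> sh a; rewrite /= (dual_pair_coext sh) preimage_setC. Qed.

Lemma dual_pair_exists_fun s : exists h, dual_pair p1 p2 s h.
Proof.
suff /choice[h sh] : forall a, exists b, p1 b = hom_X s @^-1` p2 a by exists h.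
move=> a; apply: ext_surj.
  exact: preimage_clopen (ext_clopen p2 a) (tscp_hom_contX (tscp_homP s)).
rewrite /rel_closed dia_preimage; last exact: downset_ext.
by rewrite box_preimage ?ext_closed //; exact: downset_dia.
Qed.

Lemma dual_pair_hom s h : dual_pair p1 p2 s h -> bounded_lattice_hom h.
Proof.
move=> sh; have sh' := dual_pair_coext sh; split=> [a b|a b||].
- by apply: (@ext_inj _ _ _ p1); rewrite ext_meet !sh ext_meet.
- by apply: (@coext_inj _ _ _ p1); rewrite coext_join !sh' coext_join.
- by apply: (@coext_inj _ _ _ p1); rewrite sh' !coext_bot.
- by apply: (@ext_inj _ _ _ p1); rewrite sh !ext_top.
Qed.

Lemma dual_pair_eq_fun s h h' : dual_pair p1 p2 s h -> dual_pair p1 p2 s h' ->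
  h = h'.
Proof.
move=> sh sh'; apply/funext => a.
by apply: (@ext_inj _ _ _ p1); rewrite sh sh'.
Qed.

(** Admissibility of [M] means that a union of sets is R-closed, and this is
    preserved by taking preimages. *)
Lemma dual_pair_join_admissible s h : half_tight (@tscp_R P2) ->
  dual_pair p1 p2 s h -> forall M : {fset L2}, join_admissible M ->
  join_admissible [fset h m | m in M]%fset.
Proof.
move=> ht sh M admM; apply: join_admissible_of_bigcup (p1) _ _.
have le : (\join_(n <- [fset h m | m in M]%fset) n <= h (\join_(m <- M) m))%O.
  apply/joinsP_seq => n /imfsetP[m /= mM ->] _.
  by apply/(ext_le p1); rewrite !sh => x; apply: ext_mono; exact: joins_sup_seq.
move=> x /(ext_mono le); rewrite sh /= bigcup_of_join_admissible //.
move=> -[m mM pm].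
exists (h m); last by rewrite sh.
by rewrite /=; apply/imfsetP; exists m.
Qed.

End DualPair.

Section DualPairPoints.
Context {d1} {L1 : tbLatticeType d1} {d2} {L2 : tbLatticeType d2} {P1 P2 : tscp}
  (p1 : presentation L1 P1) (p2 : presentation L2 P2).
Implicit Types (s : tscp_hom P1 P2) (h : L2 -> L1).

Lemma dual_pair_eq_homX s t h : dual_pair p1 p2 s h -> dual_pair p1 p2 t h ->
  hom_X s = hom_X t.
Proof.
move=> sh th; apply/funext => x; apply: (ext_separates (p := p2)) => a.
have := congr1 (@^~ x) (sh a); rewrite th /= => e.
by split; rewrite /preimage /= in e *; rewrite e.
Qed.

Lemma hom_joins h (M : {fset L2}) : bounded_lattice_hom h ->
  h (\join_(m <- M) m)%O = (\join_(n <- [fset h m | m in M]%fset) n)%O.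
Proof.
case=> _ hU h0 _; rewrite (big_morph h hU h0).
apply: le_anti; apply/andP; split; apply/joinsP_seq.
  by move=> m mM _; apply: joins_sup_seq => //; apply/imfsetP; exists m.
by move=> _ /imfsetP[m /= mM ->] _; exact: joins_sup_seq.
Qed.

(** A point [x] is sent to the point of the second polarity whose trace is the
    preimage under [h] of the trace of [x]; that preimage is an a-prime filter
    because [h] preserves admissible families. *)
Lemma point_map h : half_tight (@tscp_R P1) -> bounded_lattice_hom h ->
  (forall M : {fset L2}, join_admissible M ->
     join_admissible [fset h m | m in M]%fset) ->
  exists f : tscp_X P1 -> tscp_X P2,
    continuous f /\ forall a, p1 (h a) = f @^-1` p2 a.
Proof.
move=> ht hh hadm; case: (hh) => hI hU h0 h1.
have pf x : prime_lfilter [set a | p1 (h a) x].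
  have [[F1 FI Fle] Fp] := ext_prime p1 x ht.
  split=> /= [|M admM]; last first.
    rewrite hom_joins // => /(Fp _ (hadm _ admM))[_ /imfsetP[m /= mM ->] pm].
    by exists m.
  split=> /= [|a b|a b ab].
  - by rewrite h1.
  - by rewrite hI; exact: FI.
  - apply: Fle; move: ab; rewrite !leEmeet => /eqP ab.
    by rewrite -hI ab.
have /choice[f fP] x := prime_realized p2 (pf x).
have fE a : p1 (h a) = f @^-1` p2 a by apply/seteqP; split=> x /fP.
exists f; split=> // x; apply: (cvg_ext (p := p2)) => a pa.
- have : nbhs x (p1 (h a)); last by rewrite fE.
  apply: open_nbhs_nbhs; split; last by rewrite fE.
  by case: (ext_clopen p1 (h a)).
- have : nbhs x (~` p1 (h a)); last by rewrite fE.
  apply: open_nbhs_nbhs; split; last by rewrite fE.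
  by case: (clopen_setC (ext_clopen p1 (h a))).
Qed.

(** The point [z] is found by compactness in the intersection of [inv_at y]
    with all the sets [p1 (h a)] such that [x'] is in [p2 a]. *)
Lemma dia_back_of_maps h f g : bounded_lattice_hom h ->
  (forall a, p1 (h a) = f @^-1` p2 a) ->
  (forall a, coext p1 (h a) = g @^-1` coext p2 a) ->
  forall x' y, tscp_R x' (g y) ->
    exists2 z, tscp_R z y & leX (@tscp_R P2) (f z) x'.
Proof.
case=> hI _ _ h1 fh gh x' y x'y.
have [||||z zy hz] :=
    @ext_filter_meets _ _ _ p1 [set b | exists2 a, p2 a x' & b = h a]
      (inv_at (@tscp_R P1) y).
- by exists \top%O; rewrite ?ext_top.
- by move=> _ _ [a pa ->] [b pb ->]; exists (a `&` b)%O; rewrite ?ext_meet.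
- exact: closed_inv_at p1 y.
- move=> _ [a pa ->]; have : coext p1 (h a) y by rewrite gh; exists x'.
  by move=> [z pz zy]; exists z.
exists z => //; apply/(leX_ext p2) => a pa.
have : p1 (h a) z by apply: hz; exists a.
by rewrite fh.
Qed.

End DualPairPoints.

Section Full.
Context {L1 L2 : bounded_lattice} {P1 P2 : tscp}
  (p1 : presentation L1 P1) (p2 : presentation L2 P2).

Lemma dual_pair_eq_hom (s t : tscp_hom P1 P2) (h : L2 -> L1) :
  dual_pair p1 p2 s h -> dual_pair p1 p2 t h -> s = t.
Proof.
move=> sh th; apply: tscp_hom_eq; first exact: dual_pair_eq_homX sh th.
exact: dual_pair_eq_homX (dual_pair_transpose sh) (dual_pair_transpose th).
Qed.

Lemma dual_pair_exists_admissible (s : tscp_hom P1 P2) :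
  rel_tight (@tscp_R P2) ->
  exists h : admissible_hom L2 L1, dual_pair p1 p2 s h.
Proof.
move=> /rel_tightE[ht ht']; have [h sh] := dual_pair_exists_fun p1 p2 s.
have ah : admissible h.
  split; first exact: dual_pair_join_admissible sh.
  have ht2 : half_tight (@tscp_R (transpose P2)) := ht'.
  have := dual_pair_join_admissible ht2 (dual_pair_transpose sh).
  exact.
by exists (AdmissibleHom (dual_pair_hom sh) ah).
Qed.

Lemma dual_pair_exists_hom (h : admissible_hom L2 L1) :
  rel_tight (@tscp_R P1) -> exists s : tscp_hom P1 P2, dual_pair p1 p2 s h.
Proof.
move=> /rel_tightE[ht ht']; case: h => h hh [hj hm] /=.
have hh' : @bounded_lattice_hom _ L2^d _ L1^d h by case: hh.
have [f [cf fE]] := point_map p1 p2 ht hh hj.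
have [g [cg gE']] :=
  point_map (dual_presentation p1) (dual_presentation p2) ht' hh' hm.
have gE a : coext p1 (h a) = g @^-1` coext p2 a.
  by apply: setC_inj; exact: gE'.
suff hfg : is_tscp_hom f g by exists (TscpHom hfg).
split=> //.
- move=> x y xy; apply: contrapT => /(presentation_sep p2)[a pa []].
  have : coext p1 (h a) y by exists x => //; rewrite fE.
  by rewrite gE.
- exact: dia_back_of_maps hh fE gE.
- have fE' a : coext (dual_presentation p1) (h a) =
      f @^-1` coext (dual_presentation p2) a.
    by rewrite !dual_coext fE preimage_setC.
  have db := dia_back_of_maps hh' gE' fE'.
  by move=> x y' /db[w xw y'w]; exists w.
Qed.

End Full.

(** * The spectrum of a lattice *)

(** Points of the second space of the spectrum are elements of [spec L^d], so
    the topology has to be defined only once. *)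
Definition spec d (L : tbLatticeType d) : Type :=
  {F : set L | prime_lfilter F}.

Section Spec.
Context {d} {L : tbLatticeType d}.
Implicit Types (a b : L) (F : spec L).

HB.instance Definition _ := gen_eqMixin (spec L).
HB.instance Definition _ := gen_choiceMixin (spec L).

Definition spec_ext a : set (spec L) := [set F | sval F a].

Definition spec_subbase : set (set (spec L)) :=
  range spec_ext `|` range (fun a => ~` spec_ext a).

HB.instance Definition _ :=
  @isSubBaseTopological.Build (spec L) _ spec_subbase id.

Lemma open_spec_subbase (U : set (spec L)) : spec_subbase U -> open U.
Proof.
move=> sU; exists [set U]; last by rewrite bigcup_set1.
move=> _ ->; exists [fset U]%fset.
  by move=> V /fset1P->; exact: mem_set.
by rewrite set_fset1 bigcap_set1.
Qed.

Lemma clopen_spec_ext a : clopen (spec_ext a).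
Proof.
split; first by apply: open_spec_subbase; left; exists a.
rewrite -[spec_ext a]setCK; apply: open_closedC.
by apply: open_spec_subbase; right; exists a.
Qed.

Lemma cvg_spec (G : set_system (spec L)) F : Filter G ->
  (forall U, spec_subbase U -> U F -> G U) -> G --> F.
Proof.
move=> FG GU A; rewrite nbhsE => -[_ [[B sB <-] [C BC CF]] sUBA].
rewrite nbhs_filterE; apply: filterS sUBA _; apply: (@filterS _ _ _ C).
  by move=> ? ?; exists C.
have /sB [D sD IDeC] := BC; rewrite -IDeC; apply: filter_bigI => E DE.
apply: GU; first by have := sD _ DE; rewrite inE.
by move: CF; rewrite -IDeC => /(_ _ DE).
Qed.

Lemma ultra_bigcup T I (G : set_system T) (s : seq I) (A : I -> set T) :
  UltraFilter G -> G (\big[setU/set0]_(i <- s) A i) ->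
  has (fun i => `[< G (A i) >]) s.
Proof.
move=> UG; elim: s => [|i s IH]; first by rewrite big_nil => /filter_ex[].
rewrite big_cons /= => GU; apply/orP.
have [GA|GA] := in_ultra_setVsetC (A i) UG; first by left; apply/asboolP.
right; apply: IH; apply: filterS (filterI GU GA) => x [[]//].
Qed.

(** An ultrafilter [G] converges to the set of [a] such that [spec_ext a] is
    in [G].  This set is an a-prime filter because an ultrafilter that contains
    a finite union contains one of its terms. *)
Lemma compact_spec : compact [set: spec L].
Proof.
rewrite compact_ultra => G UG _.
have pf : prime_lfilter [set a | G (spec_ext a)].
  split=> /= [|M admM GM]; last first.
    have /ultra_bigcup : G (\big[setU/set0]_(m <- M) spec_ext m).
      apply: filterS GM => F; case: (svalP F) => _ /(_ _ admM) Fp /Fp[m mM Fm].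
      by rewrite -bigcup_seq; exists m.
    by move=> /hasP[m mM /asboolP Gm]; exists m.
  split=> /= [|a b Ga Gb|a b ab].
  - by apply: filterS filterT => F _; case: (svalP F) => -[].
  - apply: filterS (filterI Ga Gb) => F [Fa Fb].
    by case: (svalP F) => -[_ FI _] _; exact: FI.
  - by apply: filterS => F; case: (svalP F) => -[_ _ Fle] _; exact: Fle.
exists (exist _ _ pf); split=> //; apply: cvg_spec => _ [[a _ <-]|[a _ <-]] //.
by move=> /= nGa; have [] := in_ultra_setVsetC (spec_ext a) UG.
Qed.

Lemma spec_ext_meet a b : spec_ext (a `&` b)%O = spec_ext a `&` spec_ext b.
Proof.
apply/seteqP; split=> F; case: (svalP F) => -[_ FI Fle] _; rewrite /spec_ext /=.
  by move=> Fab; split; apply: Fle Fab; [exact: leIl|exact: leIr].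
by case; exact: FI.
Qed.

(** First, each point of [U] has a neighbourhood [spec_ext a] inside [U], since
    otherwise compactness gives a larger filter outside [U]; then [U], being
    compact, is covered by finitely many of these. *)
Lemma clopen_upset_spec (U : set (spec L)) : clopen U ->
  (forall F G, sval F `<=` sval G -> U F -> U G) ->
  exists M : {fset L}, U = \bigcup_(m in [set` M]) spec_ext m.
Proof.
move=> [oU cU] up.
have cE a : closed (spec_ext a) by case: (clopen_spec_ext a).
have loc F : U F -> exists2 a, sval F a & spec_ext a `<=` U.
  move=> UF; apply: contrapT => nU; case: (svalP F) => -[F1 FI _] _.
  have [|a b Fa Fb|a Fa|a Fa|G hG] := @compact_directed _ _ (sval F)
    (fun a => spec_ext a `&` ~` U) compact_spec.
  - by exists \top%O.
  - exists (a `&` b)%O; first exact: FI.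
    by rewrite spec_ext_meet => G [[? ?] ?].
  - by apply: closedI => //; exact: open_closedC.
  - apply: contrapT => e; apply: nU; exists a => // G Ga.
    by apply: contrapT => nUG; apply: e; exists G.
  - have [_ nUG] := hG _ F1; apply: nUG.
    by apply: (up F G) => // a /hG[].
pose D := [set M : {fset L} | forall m, m \in M -> spec_ext m `<=` U].
apply: contrapT => nM.
have [|M N DM DN|M _|M DM|H hH] := @compact_directed _ _ D
    (fun M : {fset L} => U `&` \bigcap_(m in [set` M]) ~` spec_ext m)
    compact_spec.
- by exists fset0.
- exists (M `|` N)%fset; first by move=> m /fsetUP[/DM|/DN].
  by move=> G [UG h]; split; split=> // m mM; apply: h; rewrite /= inE mM ?orbT.
- apply: closedI => //; apply: closed_bigI => m _; apply: open_closedC.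
  by case: (clopen_spec_ext m).
- apply: contrapT => e; apply: nM; exists M.
  apply/seteqP; split=> [G UG|G [m mM]].
    apply: contrapT => nG; apply: e; exists G; split=> // m mM Gm.
    by apply: nG; exists m.
  exact: DM mM _.
have [UH _] : (U `&` \bigcap_(m in [set` fset0]) ~` spec_ext m) H by exact: hH.
have [a Fa aU] := loc _ UH.
have [|_ /(_ a)] := hH [fset a]%fset; first by move=> m /fset1P->.
by rewrite /= inE; apply.
Qed.

End Spec.

Definition spec_rel d (L : tbLatticeType d) (F : spec L) (I : spec L^d) :=
  forall a : L, sval F a -> ~ sval I a.

(** [L^d^d] is convertible to [L], so the transposed spectrum of [L] is the
    spectrum of [L^d]. *)
Lemma spec_rel_flip d (L : tbLatticeType d) :
  flip (@spec_rel d L) = @spec_rel _ L^d :> (spec L^d -> spec L -> Prop).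
Proof.
apply/funext => I; apply/funext => F; apply/propext.
by split=> FI a /[swap] /FI.
Qed.

Section SpecSep.
Context {d} {L : tbLatticeType d}.
Local Notation R := (@spec_rel d L).
Implicit Types (a b : L) (F : spec L) (I : spec L^d) (M : {fset L}).

Lemma spec_separate a (F : set L) : lfilter F -> ~ F a ->
  exists2 I : spec L^d, sval I a & forall b, F b -> ~ sval I b.
Proof.
move=> [F1 FI Fle] nFa.
have [|b ba Fb|I [pI sI dI _]] :=
    @prime_filter_theorem _ L^d [set b | (b <= a)%O] F (lfilter_up (a : L^d)).
- by split.
- exact/nFa/(Fle b).
- exists (exist _ I pI); first by apply: sI => /=.
  by move=> b Fb /dI.
Qed.

Lemma leX_spec F' F : leX R F' F <-> sval F `<=` sval F'.
Proof.
split=> [le a Fa|FF' I F'I a /FF'/F'I//].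
apply: contrapT => /(spec_separate (svalP F').1)[I Ia F'I].
exact: (le I F'I) Fa Ia.
Qed.

Lemma antisym_spec : antisym (leX R).
Proof.
by move=> [F pF] [G pG] /leX_spec GF /leX_spec FG; exact/eq_exist/seteqP.
Qed.

End SpecSep.

Section SpecTscp.
Context {d} {L : tbLatticeType d}.
Local Notation R := (@spec_rel d L).
Implicit Types (a b : L) (F : spec L) (I : spec L^d) (M : {fset L}).

Lemma dia_spec_ext a : dia R (spec_ext a) = ~` @spec_ext _ L^d a.
Proof.
apply/seteqP; split=> [I [F Fa FI]|I nIa]; first exact: FI.
have [F Fa IF] := @spec_separate _ L^d a _ (svalP I).1 nIa.
by exists F => // b Fb /IF; exact.
Qed.

Lemma ideal_joins (J : set L) M : @lfilter _ L^d J ->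
  J (\join_(m <- M) m)%O <-> forall m, m \in M -> J m.
Proof.
move=> [J0 JU Jle]; split=> [JM m mM|JM].
  by apply: Jle JM; exact: (joins_sup_seq id).
by rewrite big_seq; exact: (big_ind J).
Qed.

(** A prime ideal contains the join of [M] iff it contains all of [M]. *)
Lemma dia_spec_bigcup M :
  dia R (\bigcup_(m in [set` M]) spec_ext m) =
  dia R (spec_ext (\join_(m <- M) m)%O).
Proof.
rewrite dia_bigcup dia_spec_ext; apply/seteqP; split=> I.
  move=> [m /= mM]; rewrite dia_spec_ext => nIm.
  by move=> /(ideal_joins _ (svalP I).1)/(_ _ mM).
move=> nI; apply: contrapT => nm; apply: nI.
apply/(ideal_joins _ (svalP I).1) => m mM.
by apply: contrapT => nIm; apply: nm; exists m => //; rewrite dia_spec_ext.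
Qed.

Lemma clopen_downset_spec U : clopen U -> downsetX R U ->
  exists M, U = \bigcup_(m in [set` M]) spec_ext m.
Proof.
move=> cU dU; apply: clopen_upset_spec => // F G FG.
by apply: dU; exact/leX_spec.
Qed.

Lemma clopen_dia_spec U : clopen U -> downsetX R U -> clopen (dia R U).
Proof.
move=> cU /(clopen_downset_spec cU)[M ->].
by rewrite dia_spec_bigcup dia_spec_ext; exact/clopen_setC/clopen_spec_ext.
Qed.

(** A clopen down-set [U] is the union of [spec_ext m] over a finite [M], and
    its R-closure is [spec_ext (\join M)]; so one has to show that [M] is
    join-admissible when [U] is R-regular.  If admissibility fails at [a], take
    an a-prime ideal [I] above [b := \join (a `&` m)] avoiding
    [c := a `&` \join M], and an a-prime filter [F] containing [c] that is
    maximal among filters disjoint from [I].  By maximality [I] is related to no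
    point strictly below [F], so R-regularity applies and puts [F] in [U]: some
    [m] in [M] is in [F], hence so are [a `&` m] and [b], although [b] is in
    [I]. *)
Lemma half_tight_spec : half_tight R.
Proof.
move=> U [cU dU regU]; have [M UM] := clopen_downset_spec cU dU.
suff MU : spec_ext (\join_(m <- M) m)%O `<=` U.
  apply/seteqP; split; last exact: sub_box_dia.
  rewrite {1}UM dia_spec_bigcup => F FU; apply: MU; apply: contrapT.
  move=> /(spec_separate (svalP F).1)[I IM /FU].
  by rewrite dia_spec_ext; exact.
suff admM : join_admissible M.
  move=> F; case: (svalP F) => _ /(_ _ admM) FM /FM[m mM Fm].
  by rewrite UM; exists m.
move=> a; apply: le_anti; apply/andP; split; last first.
  apply/joinsP_seq => m mM _; apply: leI2 => //; exact: (joins_sup_seq id).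
set b := (\join_(m <- M) (a `&` m))%O; set c := (a `&` _)%O.
apply: contrapT => ncb.
have [I Ib cI] := spec_separate (lfilter_up c) ncb.
have [|F [pF sF dF Fmax]] := prime_filter_theorem (lfilter_up c) _ cI.
  exact: (svalP I).1.
have Fc : F c by apply: sF => /=.
have [[F1 FI Fle] _] := pF.
have [m mM Fm] : exists2 m, m \in M & F m.
  suff : U (exist _ F pF) by rewrite UM => -[m mM Fm]; exists m.
  apply: regU => [E|J FJ].
    have : rel_at R (exist _ F pF) I by [].
    rewrite E => -[G [/leX_spec /= FG neG] GI]; apply: neG.
    case: G => G pG /= in FG GI *; apply/eq_exist/seteqP; split=> //.
    by apply: Fmax => //; exact: pG.1.
  rewrite UM -/(dia _ _) dia_spec_bigcup; exists (exist _ F pF) => //.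
  by apply: Fle Fc; exact: leIr.
have Fb : F b.
  apply: Fle (FI _ _ (Fle _ _ (leIl _ _) Fc) Fm).
  exact: (joins_sup_seq (fun m => a `&` m)%O).
exact: dF Fb Ib.
Qed.

End SpecTscp.

Section SpecPresentation.
Context {d} {L : tbLatticeType d}.
Local Notation R := (@spec_rel d L).

Lemma box_spec_ext (a : L) : box R (~` @spec_ext _ L^d a) = spec_ext a.
Proof.
apply: setC_inj; rewrite -dia_flip spec_rel_flip.
exact: (@dia_spec_ext _ L^d).
Qed.

Lemma is_tscp_spec : is_tscp R.
Proof.
split.
- exact: compact_spec.
- exact: compact_spec.
- exact: antisym_spec.
- have := @antisym_spec _ L^d; rewrite -spec_rel_flip => anti I J IJ JI.
  exact: anti.
- exact: clopen_dia_spec.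
- move=> V cV dV; rewrite -[V]setCK -[box _ _]setCK -dia_flip.
  apply: clopen_setC.
  rewrite spec_rel_flip; apply: (@clopen_dia_spec _ L^d).
    by exact: clopen_setC.
  by rewrite -spec_rel_flip => I J IJ nVJ VI; apply: nVJ; exact: dV VI.
- move=> F I /existsNP[a /not_implyP[Fa /contrapT Ia]].
  exists (spec_ext a), (~` @spec_ext _ L^d a).
  split; [exact: clopen_spec_ext|exact/clopen_setC/clopen_spec_ext|
    exact: dia_spec_ext|exact: box_spec_ext|by split].
Qed.

Definition spec_tscp : tscp := Tscp is_tscp_spec.

Lemma tight_spec : tight spec_tscp.
Proof.
apply/rel_tightE; split; first exact: half_tight_spec.
by rewrite /= spec_rel_flip; exact: half_tight_spec.
Qed.

Lemma rel_closed_spec_ext (a : L) : rel_closed R (spec_ext a).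
Proof. by rewrite /rel_closed dia_spec_ext box_spec_ext. Qed.

Lemma spec_ext_le (a b : L) : spec_ext a `<=` spec_ext b <-> (a <= b)%O.
Proof.
split=> [ab|ab F]; last first.
  by case: (svalP F) => -[_ _ Fle] _; exact: Fle.
apply: contrapT => nab.
have [I Ib aI] := spec_separate (lfilter_up a) nab.
have [|F [pF sF dF _]] := prime_filter_theorem (lfilter_up a) _ aI.
  exact: (svalP I).1.
by apply: dF Ib; apply: (ab (exist _ F pF)); apply: sF => /=.
Qed.

Lemma spec_ext_surj U : clopen U -> rel_closed R U -> exists a, spec_ext a = U.
Proof.
move=> cU clU; have [|M UM] := clopen_downset_spec cU.
  by rewrite -clU; exact: downset_box.
exists (\join_(m <- M) m)%O.
by rewrite -clU UM dia_spec_bigcup dia_spec_ext box_spec_ext.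
Qed.

Definition spec_presentation : presentation L spec_tscp :=
  @Presentation _ L spec_tscp spec_ext clopen_spec_ext rel_closed_spec_ext
    spec_ext_le spec_ext_surj.

End SpecPresentation.

(** * The lattice of clopen R-closed sets *)

Definition clopen_closed (P : tscp) : Type :=
  {U : set (tscp_X P) | clopen U /\ rel_closed (@tscp_R P) U}.

Section ClopenClosed.
Context {P : tscp}.
Local Notation R := (@tscp_R P).
Local Notation T := (clopen_closed P).
Implicit Types (U V W : T).

HB.instance Definition _ := gen_eqMixin T.
HB.instance Definition _ := gen_choiceMixin T.

Definition cc_le : rel T := fun U V => `[< sval U `<=` sval V >].

Lemma cc_le_refl : reflexive cc_le. Proof. by move=> U; exact/asboolP. Qed.

Lemma cc_le_anti : antisymmetric cc_le.
Proof.
move=> [U pU] [V pV] /andP[/asboolP UV /asboolP VU].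
by apply: eq_exist; exact/seteqP.
Qed.

Lemma cc_le_trans : transitive cc_le.
Proof.
by move=> V U W /asboolP UV /asboolP VW; apply/asboolP; exact: subset_trans VW.
Qed.

HB.instance Definition _ :=
  Order.Le_isPOrder.Build (Order.Disp tt tt) T
    cc_le_refl cc_le_anti cc_le_trans.

Lemma cc_leP U V : reflect (sval U `<=` sval V) (U <= V)%O.
Proof. exact: asboolP. Qed.

Lemma cc_downset U : downsetX R (sval U).
Proof. by case: (svalP U) => _ <-; exact: downset_box. Qed.

Lemma cc_meet_proof U V :
  clopen (sval U `&` sval V) /\ rel_closed R (sval U `&` sval V).
Proof.
case: U V => [U [cU clU]] [V [cV clV]] /=; split; first exact: clopenI.
apply/seteqP; split; last exact: sub_box_dia.
by move=> x h; split; [rewrite -clU|rewrite -clV];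
  apply: box_mono h; apply: dia_mono => ? [].
Qed.
Definition cc_meet U V : T := exist _ _ (cc_meet_proof U V).

Lemma cc_closure_proof (S : set (tscp_X P)) : clopen S -> downsetX R S ->
  clopen (box R (dia R S)) /\ rel_closed R (box R (dia R S)).
Proof.
move=> cS dS; split; last exact: box_dia_box.
apply: (tscp_box (tscpP P)); last exact: downset_dia.
exact: (tscp_dia (tscpP P)).
Qed.

(** Clopen down-sets are closed under union but R-closed sets are not: joins
    are taken in the lattice of R-closed sets. *)
Definition cc_closure S (cS : clopen S) (dS : downsetX R S) : T :=
  exist _ _ (cc_closure_proof cS dS).

Lemma cc_closure_le S (cS : clopen S) (dS : downsetX R S) U :
  (cc_closure cS dS <= U)%O <-> S `<=` sval U.
Proof.
split=> [/cc_leP /= SU|SU].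
  by apply: subset_trans SU; exact: sub_box_dia.
apply/cc_leP => /=; case: (svalP U) => _ <-.
by apply: box_mono; exact: dia_mono.
Qed.

Lemma cc_downsetU U V : downsetX R (sval U `|` sval V).
Proof.
by move=> x' x x'x [Ux|Vx]; [left|right]; apply: cc_downset x'x _.
Qed.

Definition cc_join U V : T :=
  cc_closure (clopenU (svalP U).1 (svalP V).1) (@cc_downsetU U V).

Lemma cc_meetP U V W : (U <= cc_meet V W)%O = (U <= V)%O && (U <= W)%O.
Proof.
apply/cc_leP/andP => /= [h|[/cc_leP UV /cc_leP UW] x Ux].
  by split; apply/cc_leP => x /h[].
by split; [exact: UV|exact: UW].
Qed.

Lemma cc_joinP U V W : (cc_join U V <= W)%O = (U <= W)%O && (V <= W)%O.
Proof.
apply/idP/andP => [/cc_closure_le h|[/cc_leP UW /cc_leP VW]].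
  by split; apply/cc_leP => x hx; apply: h; [left|right].
by apply/cc_closure_le => x [/UW|/VW].
Qed.

HB.instance Definition _ :=
  Order.POrder_MeetJoin_isLattice.Build (Order.Disp tt tt) T cc_meetP cc_joinP.

Lemma cc_downset0 : downsetX R set0. Proof. by []. Qed.
Lemma cc_downsetT : downsetX R setT. Proof. by []. Qed.

Definition cc_bot : T := cc_closure clopen0 cc_downset0.
Definition cc_top : T := cc_closure clopenT cc_downsetT.

Lemma cc_le0x U : (cc_bot <= U)%O.
Proof. by apply/cc_closure_le => x. Qed.

Lemma cc_lex1 U : (U <= cc_top)%O.
Proof. by apply/cc_leP => x _ /=; exact: sub_box_dia. Qed.

HB.instance Definition _ := Order.hasBottom.Build (Order.Disp tt tt) T cc_le0x.
HB.instance Definition _ := Order.hasTop.Build (Order.Disp tt tt) T cc_lex1.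

Lemma cc_ext_surj (S : set (tscp_X P)) : clopen S -> rel_closed R S ->
  exists U : T, sval U = S.
Proof. by move=> cS clS; exists (exist _ S (conj cS clS)). Qed.

Definition cc_presentation : presentation (T : tbLatticeType _) P :=
  @Presentation _ (T : tbLatticeType _) P (fun U => sval U)
    (fun U => (svalP U).1) (fun U => (svalP U).2)
    (fun U V => rwP (cc_leP U V)) cc_ext_surj.

End ClopenClosed.

(** * The duality *)

Lemma dual_pair_id (L : bounded_lattice) P (p : presentation L P) :
  dual_pair p p (tscp_id P) (admissible_id L).
Proof. by []. Qed.

Lemma dual_pair_comp (L1 L2 L3 : bounded_lattice) P1 P2 P3
    (p1 : presentation L1 P1) (p2 : presentation L2 P2)
    (p3 : presentation L3 P3) (s : tscp_hom P1 P2) (t : tscp_hom P2 P3)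
    (f : admissible_hom L2 L1) (g : admissible_hom L3 L2) :
  dual_pair p1 p2 s f -> dual_pair p2 p3 t g ->
  dual_pair p1 p3 (tscp_comp t s) (admissible_comp f g).
Proof. by move=> sf tg a; rewrite /= sf tg. Qed.

Definition presented (L : opposite La) (P : tTSCP) : Type :=
  @presentation _ (L : bounded_lattice) (sval P).

Definition presented_pair (L1 : opposite La) (P1 : tTSCP) (L2 : opposite La)
    (P2 : tTSCP) (p1 : presented L1 P1) (p2 : presented L2 P2)
    (f : hom L1 L2) (s : hom P1 P2) : Prop :=
  dual_pair p1 p2 (s : tscp_hom (sval P1) (sval P2)) (f : admissible_hom L2 L1).

Lemma presented_full_span : full_span presented_pair.
Proof.
split.
- by move=> L; exists (exist _ (spec_tscp (L := L)) tight_spec);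
    exact: spec_presentation.
- move=> [P tP]; exists (@BoundedLattice _ (clopen_closed P : tbLatticeType _)).
  exact: cc_presentation.
- by move=> L P p; exact: dual_pair_id.
- by move=> L1 P1 L2 P2 L3 P3 p1 p2 p3 f s g t; exact: dual_pair_comp.
- by move=> L1 [P1 t1] L2 P2 p1 p2 f; exact: dual_pair_exists_hom.
- by move=> L1 P1 L2 [P2 t2] p1 p2 s; exact: dual_pair_exists_admissible.
- by move=> L1 P1 L2 P2 p1 p2 f s t; exact: dual_pair_eq_hom.
- move=> L1 P1 L2 P2 p1 p2 f g s fs gs.
  exact/admissible_hom_eq/(dual_pair_eq_fun fs gs).
Qed.

Theorem theorem4p19 : dually_equivalent La tTSCP.
Proof. exact: equivalent_of_span presented_full_span. Qed.
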